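(* For $\mathbf F\in\mathcal M_1^n$ and $\Lambda\in\mathcal Q_n$, we have $\mathcal C(\mathbf F)\subset\mathcal C(\Lambda\mathbf F)$.
   Context: $\mathcal M_1$ is the set of cdfs on $\mathbb{R}$ with finite mean. For $F,G\in\mathcal M_1$, $F\prec_{\mathrm{cx}}G$ (convex order) means $\int\phi\,\mathrm dF\le\int\phi\,\mathrm dG$ for all convex $\phi:\mathbb{R}\to\mathbb{R}$. The quantile function of a cdf $F$ is $F^{-1}(p)=\inf\{x: F(x)\ge p\}$, $p\in(0,1)$. For cdfs $F_1,\dots,F_n$, $F_1\oplus\dots\oplus F_n$ denotes the cdf with quantile function $F_1^{-1}+\dots+F_n^{-1}$. For $\mathbf F=(F_1,\dots,F_n)\in\mathcal M_1^n$, $\mathcal C(\mathbf F)=\{G\in\mathcal M_1: G\prec_{\mathrm{cx}}F_1\oplus\dots\oplus F_n\}$. $\mathcal Q_n$ is the set of $n\times n$ doubly stochastic matrices; for $\Lambda=(\Lambda_{ij})\in\mathcal Q_n$, $\Lambda\mathbf F$ is the tuple with $i$-th component $\sum_j\Lambda_{ij}F_j$. *)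

(* Defs.v *)
From HB Require Import structures.
From mathcomp Require Import all_boot all_order all_algebra.
From mathcomp Require Import all_classical all_reals all_analysis.
Set Implicit Arguments. Unset Strict Implicit. Unset Printing Implicit Defensive.
Import Order.TTheory GRing.Theory Num.Theory.
Import numFieldNormedType.Exports.
Local Open Scope classical_set_scope.
Local Open Scope ring_scope.

Section Defs.
Variable R : realType.

Definition is_cdf (F : R -> R) : Prop :=
  [/\ {homo F : x y / x <= y},
      (forall x, F @ at_right x --> F x),
      F @ -oo --> (0:R) & F @ +oo --> (1:R)].

Definition cum_of (F : R -> R) : cumulative R R :=
  match pselect ({homo F : x y / x <= y} /\ (forall x, F @ at_right x --> F x)) with
  | left h => HB.pack_for (cumulative R R) F
                (isCumulative.Build R _ R F h.1 h.2)
  | right _ => [the cumulative R R of idfun]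
  end.

Definition LS (F : R -> R) := lebesgue_stieltjes_measure (cum_of F).

Definition cdf_int (F : R -> R) (phi : R -> R) : \bar R :=
  (\int[LS F]_x (phi x)%:E)%E.

Definition M1 : set (R -> R) :=
  [set F | is_cdf F /\ (LS F).-integrable setT (fun x : R => x%:E)].

Definition convex_fun (phi : R -> R) : Prop :=
  forall x y t, 0 <= t <= 1 ->
    phi (t * x + (1 - t) * y) <= t * phi x + (1 - t) * phi y.

Definition cx_le (F G : R -> R) : Prop :=
  forall phi : R -> R, convex_fun phi -> (cdf_int F phi <= cdf_int G phi)%E.

Definition quantile (F : R -> R) (p : R) : R := inf [set x | p <= F x].

(* the cdf whose quantile function is Q (Q nondecreasing, left-continuous
   on (0,1)): x |-> sup {p in (0,1) | Q p <= x}  (0 if this set is empty) *)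
Definition cdf_of_quantile (Q : R -> R) (x : R) : R :=
  sup [set p | 0 < p < 1 /\ Q p <= x].

Definition comon_sum n (F : 'I_n -> R -> R) : R -> R :=
  cdf_of_quantile (fun p => \sum_(i < n) quantile (F i) p).

Definition Cset n (F : 'I_n -> R -> R) : set (R -> R) :=
  [set G | M1 G /\ cx_le G (comon_sum F)].

Definition doubly_stochastic n (L : 'M[R]_n) : Prop :=
  [/\ forall i j, 0 <= L i j,
      forall i, \sum_(j < n) L i j = 1
    & forall j, \sum_(i < n) L i j = 1].

Definition mixF n (L : 'M[R]_n) (F : 'I_n -> R -> R) : 'I_n -> R -> R :=
  fun i x => \sum_(j < n) L i j * F j x.

End Defs.

(* Main.v *)
(** Everything is transported to the uniform distribution on (0,1).  Let [Q_j]
be the quantile functions of the [F_j], let [H_i] be those of the mixtures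
[\sum_j L_ij F_j], and let [Q], [H] be the sums of the [Q_j] and of the [H_i].
For an up-set [U] of (0,1), let [h] be the supremum of [H_i] off [U].  Then
[1_U (H_i - h) = (H_i - h)^+] pointwise, and, since [H_i] has the law of the
mixture, [E (H_i - h)^+ = \sum_j L_ij E (Q_j - h)^+], which is at least
[\sum_j L_ij E (1_U (Q_j - h))].  Summing over [i], the column sums of [L]
give [E (1_U (H - Q)) >= 0]; in the same way [E (H - Q) = 0].  Approximation by
staircases extends this to [E (v (H - Q)) >= 0] for every bounded nondecreasing
weight [v].  A convex [phi] with subgradient [g] satisfies
[phi(H) >= phi(Q) + g(Q) (H - Q)], where [g(Q)] is a nondecreasing function of
[p]; to make it bounded, [phi] is first replaced, outside of [[-N, N]], by its
tangents at [-N] and [N], and Fatou's lemma lets [N] tend to infinity. *)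
Require Import Defs.
From HB Require Import structures.
From mathcomp Require Import all_boot all_order all_algebra.
From mathcomp Require Import all_classical all_reals all_analysis.
From mathcomp Require Import measurable_realfun ring lra.
Set Implicit Arguments. Unset Strict Implicit. Unset Printing Implicit Defensive.
Import Order.TTheory GRing.Theory Num.Theory.
Import numFieldNormedType.Exports.
Local Open Scope classical_set_scope.
Local Open Scope ring_scope.

(** * Quantile functions and laws *)

Section quantile_transfer.
Context {R : realType}.
Implicit Types (F Q : R -> R).

Definition unit_itv : set R := `]0, 1[.

Lemma measurable_unit_itv : measurable unit_itv.
Proof. exact: measurable_itv. Qed.

Definition unif01 : set R -> \bar R :=
  mrestr (@lebesgue_measure R) measurable_unit_itv.

Let restr01 : {measure set (measurableTypeR R) -> \bar R} :=
  mrestr (@lebesgue_measure R) measurable_unit_itv.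

Let unif01_set0 : unif01 set0 = 0%E. Proof. exact: measure0 restr01. Qed.

Let unif01_ge0 A : (0 <= unif01 A)%E. Proof. exact: measure_ge0 restr01 A. Qed.

Let unif01_sigma_additive : semi_sigma_additive unif01.
Proof. exact: (@measure_semi_sigma_additive _ _ _ restr01). Qed.

HB.instance Definition _ := isMeasure.Build _ R R unif01
  unif01_set0 unif01_ge0 unif01_sigma_additive.

Lemma unit_itvP p : unit_itv p <-> 0 < p < 1.
Proof. by rewrite /unit_itv /= in_itv. Qed.

Lemma unif01_unit_itv : unif01 unit_itv = 1%E.
Proof.
rewrite /unif01 /mrestr setIid /unit_itv lebesgue_measure_itv/=.
by rewrite lte_fin ltr01 -EFinB subr0.
Qed.

Lemma unif01_setC : unif01 (~` unit_itv) = 0%E.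
Proof. by rewrite /unif01 /mrestr setICl measure0. Qed.

Lemma unif01_itvoc (a b : R) : 0 <= a -> b <= 1 -> a <= b ->
  unif01 (unit_itv `&` [set p | a < p <= b]) = (b - a)%:E.
Proof.
move=> a0 b1 ab; rewrite /unif01 /mrestr setIAC setIid setIC.
(* Intersecting with (0,1) drops the endpoint [b] exactly when [b = 1]: [BSide (b == 1) b] is then
   an open bound, and a closed one otherwise. *)
have -> : [set p | a < p <= b] `&` unit_itv =
    [set` Interval (BRight a) (BSide (b == 1) b)].
  apply/seteqP; split => p /=; rewrite /unit_itv/= !in_itv/=.
    case: eqVneq => [->|] /=; first by move=> [/andP[-> _] /andP[_ ->]].
    by move=> _ [/andP[-> ->]].
  case: eqVneq => [->|bn1] /= /andP[ap pb].
    by rewrite ap pb (ltW pb) (le_lt_trans a0 ap).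
  by rewrite ap pb (le_lt_trans a0 ap) (le_lt_trans pb)// lt_neqAle bn1.
rewrite lebesgue_measure_itv/= lte_fin EFinB; case: ltgtP ab => // -> _.
by rewrite subee.
Qed.

(** The Galois connection between a cdf and its quantile function. The change of variables rests on
    it and on the bounds of [F], so it serves both [quantile], built from [F], and
    [cdf_of_quantile], built from [Q]. *)
Definition galois_cdf F Q := forall p x, unit_itv p -> (Q p <= x) = (p <= F x).

Section galois.
Context (F Q : R -> R).
Hypotheses (F01 : forall x, 0 <= F x <= 1) (gal : galois_cdf F Q).

Lemma galois_cdf_homo : {homo F : x y / x <= y}.
Proof.
move=> x y xy; rewrite leNgt; apply/negP => FyFx.
have /andP[Fy0 _] := F01 y; have /andP[_ Fx1] := F01 x.
(* The connection holds only on (0,1); the midpoint lies there even if [F y = 0] or [F x = 1]. *)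
have Dp : unit_itv ((F x + F y) / 2) by apply/unit_itvP; lra.
have : Q ((F x + F y) / 2) <= y by apply: le_trans xy; rewrite gal//; lra.
by rewrite gal//; lra.
Qed.

(** If [1 < F x + e], the bound [F <= 1] suffices. Otherwise the level [F x + e / 2] is in (0,1),
    its quantile exceeds [x], and [F] stays below the level to the left of that quantile. *)
Lemma galois_cdf_cvg_right x : F @ at_right x --> F x.
Proof.
apply/cvgrPdist_lt => e e0.
have /andP[Fx0 Fx1] := F01 x.
have [Fxe|Fxe] := ltP 1 (F x + e).
  near=> y; have xy : x <= y by near: y; exact: nbhs_right_ge.
  have := galois_cdf_homo xy; have /andP[_ Fy1] := F01 y => FxFy.
  by rewrite ler0_norm; lra.
have Dp : unit_itv (F x + e / 2) by apply/unit_itvP; lra.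
have Qx : x < Q (F x + e / 2) by rewrite ltNge gal// -ltNge; lra.
near=> y; have xy : x <= y by near: y; exact: nbhs_right_ge.
have := galois_cdf_homo xy => FxFy.
have : y < Q (F x + e / 2) by near: y; exact: nbhs_right_lt.
by rewrite ltNge gal// -ltNge ler0_norm; lra.
Unshelve. all: by end_near. Qed.

Lemma galois_quantile_homo : {in unit_itv &, {homo Q : p q / p <= q}}.
Proof.
move=> p q; rewrite !inE => Dp Dq pq.
by rewrite gal// (le_trans pq)// -gal.
Qed.

End galois.

Lemma homo_measurable Q : {in unit_itv &, {homo Q : p q / p <= q}} ->
  measurable_fun unit_itv Q.
Proof.
move=> ndQ; apply: (measurability (@RGenCInfty.G R)) => [|/= _ [_] [r] -> <-].
  exact: RGenCInfty.measurableE.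
apply: is_interval_measurable => s t /=.
rewrite /unit_itv /= !in_itv/= !andbT => -[/andP[s0 s1] rs] [/andP[t0 t1] rt].
move=> u /andP[su ut].
have u01 : 0 < u < 1 by rewrite (lt_le_trans s0 su) (le_lt_trans ut t1).
rewrite !in_itv/= andbT; split => //; apply: (le_trans rs).
apply: ndQ; rewrite ?inE; [|exact/unit_itvP|exact: su].
by apply/unit_itvP; rewrite s0 s1.
Qed.

Lemma cum_ofE F : {homo F : x y / x <= y} ->
  (forall x, F @ at_right x --> F x) -> cum_of F = F :> (R -> R).
Proof.
by move=> ndF rcF; rewrite /cum_of; case: pselect => // -[]; split.
Qed.

Lemma LS_itvoc F a b : {homo F : x y / x <= y} ->
  (forall x, F @ at_right x --> F x) -> a <= b ->
  LS F `]a, b]%classic = (F b - F a)%:E.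
Proof.
move=> ndF rcF ab; rewrite /LS /lebesgue_stieltjes_measure /measure_extension/=.
rewrite measurable_mu_extE/=; last exact: is_ocitv.
by rewrite wlength_itv_bnd// cum_ofE.
Qed.

(** By the connection, [Q p] lies in ]a, b] iff [F a < p <= F b], so both measures agree on
    half-open intervals, which determine a Lebesgue-Stieltjes measure. Patching [Q] by 0 makes it
    measurable on the whole line, and [unif01] does not charge the complement of (0,1). *)
Lemma LS_pushforward F Q : (forall x, 0 <= F x <= 1) ->
  galois_cdf F Q -> forall A, measurable A ->
  LS F A = pushforward unif01 (Q \_ unit_itv : R -> measurableTypeR R) A.
Proof.
move=> F01 gal A mA.
have ndF := galois_cdf_homo F01 gal.
have rcF := galois_cdf_cvg_right F01 gal.
have mQ : measurable_fun setT (Q \_ unit_itv : R -> measurableTypeR R).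
  apply/(measurable_restrictT _ _).1; first exact: measurable_unit_itv.
  exact: homo_measurable (galois_quantile_homo gal).
pose mQ_mixin := isMeasurableFun.Build _ _ _ _ _ mQ.
pose mQ_pack : {mfun _ >-> _} :=
  HB.pack (Q \_ unit_itv : R -> measurableTypeR R) mQ_mixin.
apply: (@lebesgue_stieltjes_measure_unique _ (cum_of F)
  (pushforward unif01 mQ_pack)) => // _ [[a b] _ <-] /=.
have [ab|ba] := leP a b; last first.
  by rewrite set_itv_ge ?measure0// bnd_simp -leNgt ltW.
transitivity ((F b - F a)%:E); first exact: LS_itvoc.
rewrite -unif01_itvoc ?ndF//; [|by case/andP: (F01 a)|by case/andP: (F01 b)].
rewrite /pushforward /unif01 /mrestr; congr (lebesgue_measure _).
apply/seteqP; split => p /=.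
  move=> [[Dp /andP[ap pb]] _]; split => //.
  by rewrite patchE mem_set// in_itv/= gal// pb ltNge gal// -ltNge ap.
move=> [+ Dp]; rewrite patchE mem_set// in_itv/= => /andP[].
by rewrite gal// ltNge gal// -ltNge => -> ->.
Qed.

Lemma LS_ge0_integral F Q (f : R -> \bar R) : (forall x, 0 <= F x <= 1) ->
  galois_cdf F Q -> measurable_fun setT f -> (forall x, 0 <= f x)%E ->
  (\int[LS F]_x f x = \int[unif01]_(p in unit_itv) f (Q p))%E.
Proof.
move=> F01 gal mf f0.
have mQ : measurable_fun setT (Q \_ unit_itv : R -> measurableTypeR R).
  apply/(measurable_restrictT _ _).1; first exact: measurable_unit_itv.
  exact: homo_measurable (galois_quantile_homo gal).
pose mQ_mixin := isMeasurableFun.Build _ _ _ _ _ mQ.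
pose mQ_pack : {mfun _ >-> _} :=
  HB.pack (Q \_ unit_itv : R -> measurableTypeR R) mQ_mixin.
rewrite (eq_measure_integral (pushforward unif01 mQ_pack)); last first.
  by move=> A mA _; exact: LS_pushforward.
rewrite ge0_integral_pushforward//= preimage_setT.
rewrite (ge0_negligible_integral (mu := unif01) (N := ~` unit_itv))//; last 3 first.
- exact: (measurableC measurable_unit_itv).
- exact: measurableT_comp.
- exact: unif01_setC.
rewrite setTD setCK; apply: eq_integral => p pD /=.
by rewrite patchE pD.
Qed.

(** The equality is between extended integrals, each the difference of those of the positive and
    negative parts, so it covers convex functions of infinite integral. *)
Lemma LS_integral F Q (f : R -> \bar R) : (forall x, 0 <= F x <= 1) ->
  galois_cdf F Q -> measurable_fun setT f ->
  (\int[LS F]_x f x = \int[unif01]_(p in unit_itv) f (Q p))%E.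
Proof.
move=> F01 gal mf; rewrite integralE [RHS]integralE.
have mp : measurable_fun setT f^\+%E := measurable_funepos mf.
have mn : measurable_fun setT f^\-%E := measurable_funeneg mf.
have := LS_ge0_integral F01 gal mp (funepos_ge0 f).
have := LS_ge0_integral F01 gal mn (funeneg_ge0 f).
move=> -> ->; congr (_ - _)%E; apply: eq_integral => p _.
  by rewrite !unlock.
by rewrite !unlock.
Qed.

End quantile_transfer.

Section quantiles.
Context {R : realType}.
Implicit Types (F Q : R -> R).

Lemma is_cdf_bounds F : is_cdf F -> forall x, 0 <= F x <= 1.
Proof.
move=> [ndF _ F0 F1] x; apply/andP; split; rewrite leNgt; apply/negP => Fx.
- have [y [Fy yx]] :=
    filter_ex (filterI (cvgr_gt _ F0 _ Fx) (nbhs_ninfty_le (num_real x))).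
  by have := ndF _ _ yx; rewrite leNgt Fy.
- have [y [Fy xy]] :=
    filter_ex (filterI (cvgr_lt _ F1 _ Fx) (nbhs_pinfty_ge (num_real x))).
  by have := ndF _ _ xy; rewrite leNgt Fy.
Qed.

Lemma quantile_galois F : is_cdf F -> galois_cdf F (quantile F).
Proof.
move=> [ndF rcF F0 F1] p x /unit_itvP/andP[p0 p1].
set S := [set y | p <= F y].
have S0 : S !=set0.
  have [y Fy] := filter_ex (cvgr_gt _ F1 _ p1).
  by exists y; exact: ltW.
have Sinf : has_lbound S.
  have [y Fy] := filter_ex (cvgr_lt _ F0 _ p0).
  exists y => z /= Sz; rewrite leNgt; apply/negP => zy.
  by have := ndF _ _ (ltW zy); rewrite leNgt (lt_le_trans Fy).
(* The infimum is attained: otherwise right continuity gives a point [z] to its right with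
   [F z < p], while [S] has an element below [z]. *)
have Sq : p <= F (quantile F p).
  rewrite leNgt; apply/negP => Fp.
  have FQ :
      \forall z \near at_right (quantile F p), F z < p /\ quantile F p < z.
    apply: filterI; last exact: nbhs_right_gt.
    exact: cvgr_lt _ (rcF _) _ Fp.
  have [z [Fz zp]] := @filter_ex _ _ (at_right_proper_filter (quantile F p)) _ FQ.
  have [s Ss sz] := inf_lt S0 zp.
  by have := ndF _ _ (ltW sz); rewrite leNgt (lt_le_trans Fz).
apply/idP/idP => [Qx|Fx]; first by rewrite (le_trans Sq)// ndF.
exact: ge_inf.
Qed.

(* For a nondecreasing [Q], the second clause is left continuity on (0,1). *)
Definition quantile_like Q :=
  {in unit_itv &, {homo Q : p q / p <= q}} /\
  forall p e, unit_itv p -> 0 < e ->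
    exists q, [/\ unit_itv q, q < p & Q p - e < Q q].

Lemma galois_quantile_like F Q : (forall x, 0 <= F x <= 1) ->
  galois_cdf F Q -> quantile_like Q.
Proof.
move=> F01 gal; split; first exact: galois_quantile_homo gal.
move=> p e Dp e0; have /unit_itvP/andP[p0 p1] := Dp.
have /andP[y0 y1] := F01 (Q p - e).
(* Every [q] of (0,1) above [F (Q p - e)] has [Q q > Q p - e]; the midpoint with [p] is such a [q]
   below [p]. *)
have yp : F (Q p - e) < p by rewrite ltNge -gal//; lra.
have Dq : unit_itv ((F (Q p - e) + p) / 2) by apply/unit_itvP; lra.
by exists ((F (Q p - e) + p) / 2); split => //; [lra|rewrite ltNge gal//; lra].
Qed.

Lemma quantile_like0 : quantile_like (fun=> 0).
Proof.
split=> // p e /unit_itvP p01 e0; exists (p / 2).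
by split; [apply/unit_itvP; lra|lra|lra].
Qed.

Lemma quantile_likeD Q1 Q2 : quantile_like Q1 -> quantile_like Q2 ->
  quantile_like (fun p => Q1 p + Q2 p).
Proof.
move=> [nd1 lc1] [nd2 lc2]; split.
  by move=> p q Dp Dq pq; rewrite lerD// ?nd1// nd2.
move=> p e Dp e0; have e20 : 0 < e / 2 by lra.
have [q1 [Dq1 q1p Qq1]] := lc1 _ _ Dp e20.
have [q2 [Dq2 q2p Qq2]] := lc2 _ _ Dp e20.
exists (Num.max q1 q2); have Dq : unit_itv (Num.max q1 q2).
  by case: leP.
split => //; first by rewrite gt_max q1p.
have : Q1 q1 <= Q1 (Num.max q1 q2) by rewrite nd1 ?inE// le_max lexx.
have : Q2 q2 <= Q2 (Num.max q1 q2) by rewrite nd2 ?inE// le_max lexx orbT.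
lra.
Qed.

Lemma quantile_like_sum n (Q : 'I_n -> R -> R) :
  (forall i, quantile_like (Q i)) ->
  quantile_like (fun p => \sum_(i < n) Q i p).
Proof.
move=> Qi; rewrite (_ : (fun p => _) = \sum_(i < n) Q i); last first.
  by apply/funext => p; rewrite fct_sumE.
elim/big_ind : _ => [|Q1 Q2|//]; [exact: quantile_like0|exact: quantile_likeD].
Qed.

Lemma cdf_of_quantile_bounds Q x : 0 <= cdf_of_quantile Q x <= 1.
Proof.
rewrite /cdf_of_quantile; set S := [set p | _].
have ubS : ubound S 1 by move=> p [/andP[_ /ltW]].
have [S0|/set0P/negP] := pselect (S !=set0); last first.
  by rewrite negbK => /eqP ->; rewrite sup0 lexx ler01.
rewrite ge_sup// andbT; have [p Sp] := S0; have [/andP[/ltW p0 _] _] := Sp.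
by apply: (le_trans p0); apply: ub_le_sup => //; exists 1.
Qed.

(** The converse direction needs left continuity: choose [q < p] with [Q p - e < Q q]. As [q] is
    below the supremum, some [s > q] has [Q s <= x], so [Q q <= x]. *)
Lemma cdf_of_quantile_galois Q : quantile_like Q ->
  galois_cdf (cdf_of_quantile Q) Q.
Proof.
move=> [ndQ lcQ] p x Dp; have /unit_itvP p01 := Dp.
apply/idP/idP => [Qx|px].
  by apply: ub_le_sup => //; exists 1 => q /= [/andP[_ /ltW]].
apply/ler_addgt0Pr => e e0; rewrite -lerBlDr.
have [q [Dq qp /ltW/le_trans]] := lcQ _ _ Dp e0; apply.
have /unit_itvP q01 := Dq.
have [[s [s01 Qs] qs]|/forallPNP noS] :=
    pselect (exists2 s, 0 < s < 1 /\ Q s <= x & q < s).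
  by apply: le_trans Qs; rewrite ndQ ?inE ?ltW//; exact/unit_itvP.
suff : cdf_of_quantile Q x <= q by rewrite leNgt (lt_le_trans qp).
rewrite /cdf_of_quantile; set S := [set p | _].
have [S0|/set0P/negP] := pselect (S !=set0); last first.
  by rewrite negbK => /eqP ->; rewrite sup0; lra.
by apply: ge_sup => // s Ss; rewrite leNgt; apply/negP; exact: noS.
Qed.

End quantiles.

(** * Mixtures *)

Section mixtures.
Context {R : realType}.

Section mixture.
Context (n : nat) (w : 'I_n -> R) (F : 'I_n -> R -> R).
Hypotheses (w_ge0 : forall j, 0 <= w j) (w_sum1 : \sum_(j < n) w j = 1).
Hypothesis cdfF : forall j, is_cdf (F j).

Definition mixture x := \sum_(j < n) w j * F j x.

Lemma is_cdf_mixture : is_cdf mixture.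
Proof.
have lim (G : set_system R) (l : 'I_n -> R) : Filter G ->
    (forall j, F j @ G --> l j) -> mixture @ G --> \sum_(j < n) w j * l j.
  move=> FG Fl; apply: cvg_big => [|j _]; first exact: add_continuous.
  by apply: cvgMl_tmp; exact: Fl.
split.
- move=> x y xy; apply: ler_sum => j _; apply: ler_wpM2l => //.
  by case: (cdfF j) => + _ _ _; exact.
- by move=> x; apply: lim => j; case: (cdfF j).
- have : mixture @ -oo --> \sum_(j < n) w j * 0.
    by apply: lim => j; case: (cdfF j).
  by under eq_bigr do rewrite mulr0; rewrite big1.
- have : mixture @ +oo --> \sum_(j < n) w j * 1.
    by apply: lim => j; case: (cdfF j).
  by under eq_bigr do rewrite mulr1; rewrite w_sum1.
Qed.

(** The measure of the mixture and the weighted sum of the measures agree on half-open intervals,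
    hence everywhere. *)
Lemma LS_mixture_integral (f : R -> \bar R) :
  measurable_fun setT f -> (forall x, 0 <= f x)%E ->
  (\int[LS mixture]_x f x = \sum_(j < n) (w j)%:E * \int[LS (F j)]_x f x)%E.
Proof.
move=> mf f0; have := is_cdf_mixture; rewrite /mixture.
(* No weights at all cannot sum to 1. With [m.+1] of them, [inord] turns the natural indices of
   [msum] into ordinals. *)
case: n w F w_ge0 w_sum1 cdfF => [|m] w' F' w0 w1 cF cM.
  by move: w1; rewrite big_ord0 => /esym/eqP; rewrite oner_eq0.
pose m_ k : {measure set (measurableTypeR R) -> \bar R} :=
  mscale (NngNum (w0 (inord k))) (LS (F' (inord k))).
have LSE (A : set (measurableTypeR R)) : measurable A ->
    LS (fun x => \sum_(j < m.+1) w' j * F' j x) A = msum m_ m.+1 A.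
  move=> mA; apply: lebesgue_stieltjes_measure_unique => // _ [[a b] _ <-] /=.
  have [ab|ba] := leP a b; last first.
    by rewrite set_itv_ge ?measure0// bnd_simp -leNgt ltW.
  transitivity ((\sum_(j < m.+1) w' j * F' j b - \sum_(j < m.+1) w' j * F' j a)%:E).
    by apply: LS_itvoc => //; case: cM.
  rewrite -sumrB -sumEFin /msum; apply: eq_bigr => j _.
  rewrite /m_ /mscale/= inord_val -mulrBr EFinM; congr (_ * _)%E.
  by apply/esym/LS_itvoc => //; case: (cF j).
transitivity (\int[msum m_ m.+1]_x f x)%E.
  by apply: eq_measure_integral => A mA _; exact: LSE.
rewrite ge0_integral_measure_sum//; apply: eq_bigr => j _.
have e := @ge0_integral_mscale _ (measurableTypeR R) R (LS (F' (inord j))) setT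
  measurableT (NngNum (w0 (inord j))) f mf (fun x _ => f0 x).
rewrite -[in RHS](inord_val j).
exact: e.
Qed.

(** The quantile function of a mixture is not the mixture of the quantile functions; only the laws
    mix, so linearity is available for expectations. *)
Lemma quantile_mixture_integral (f : R -> \bar R) :
  measurable_fun setT f -> (forall x, 0 <= f x)%E ->
  (\int[unif01]_(p in unit_itv) f (quantile mixture p) =
   \sum_(j < n) (w j)%:E * \int[unif01]_(p in unit_itv) f (quantile (F j) p))%E.
Proof.
move=> mf f0.
have eF G (cG : is_cdf G) :=
  LS_ge0_integral (is_cdf_bounds cG) (quantile_galois cG) mf f0.
apply: etrans (esym (eF _ is_cdf_mixture)) _.
apply: etrans (LS_mixture_integral mf f0) _.
by apply: eq_bigr => j _; congr (_ * _)%E; exact: eF.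
Qed.

End mixture.

Lemma measurable_quantile F : is_cdf F ->
  measurable_fun (@unit_itv R) (quantile F).
Proof.
by move=> cF; exact: homo_measurable (galois_quantile_homo (quantile_galois cF)).
Qed.

Lemma quantile_integrable F : M1 F ->
  unif01.-integrable (@unit_itv R) (EFin \o quantile F).
Proof.
move=> [cF /integrableP[_ iF]]; apply/integrableP; split.
  by apply/measurable_EFinP; exact: measurable_quantile.
have mabs : measurable_fun setT (fun x : R => `|x%:E|%E).
  by apply: measurableT_comp => //; exact: EFin_measurable.
have e := LS_ge0_integral (is_cdf_bounds cF) (quantile_galois cF) mabs
  (fun=> abse_ge0 _).
exact: (eq_ind _ (fun z => z < +oo)%E iF _ e).
Qed.

End mixtures.

(** * Nondecreasing weights *)

Lemma integrable_bounded_mul d (T : measurableType d) (R : realType)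
    (mu : {measure set T -> \bar R}) (D : set T) (v f : T -> R) (M : R) :
  measurable D -> measurable_fun D v -> (forall x, D x -> `|v x| <= M) ->
  mu.-integrable D (EFin \o f) -> mu.-integrable D (EFin \o (fun x => v x * f x)).
Proof.
move=> mD mv vM intf; apply: (le_integrable mD _ _ (integrableZl mD M intf)).
  apply/measurable_EFinP/measurable_funM => //.
  exact/measurable_EFinP/(measurable_int mu).
move=> x Dx /=; rewrite lee_fin !normrM ler_wpM2r//.
by rewrite (le_trans (vM _ Dx))// ler_norm.
Qed.

Section monotone_weight.
Context {R : realType}.

(** The sum counts the integers of [1, N] that are at most [z], so it is the integer part of [z]. *)
Lemma staircase_approx (N : nat) (z : R) : 0 <= z <= N%:R ->
  `|z - \sum_(k < N) (k.+1%:R <= z)%R%:R| <= 1.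
Proof.
move=> /andP[z0 zN].
(* Strengthened for the induction, during which [z] may exceed the current [N]. *)
suff [Sz [_ [_ /(_ zN) zS]]] : let S := \sum_(k < N) (k.+1%:R <= z)%R%:R in
    S <= z /\ S <= N%:R /\ (N%:R <= z -> S = N%:R) /\ (z <= N%:R -> z - 1 <= S).
  by rewrite ger0_norm; lra.
elim: N {zN} => [|N] /=.
  by rewrite big_ord0; split => //; split => //; split => // ?; lra.
move=> [Sz [SN [SNz zS]]]; rewrite big_ord_recr/= -natr1.
case: (leP (N%:R + 1) z) => zN1 /=.
  by rewrite SNz; [split; [lra|split; [lra|split; lra]]|lra].
rewrite addr0; split => //; split; first lra; split => [|_]; first lra.
by have [/zS//|/ltW/SNz ->] := leP z N%:R; lra.
Qed.

Definition upset (U : set R) := forall p q, unit_itv p -> unit_itv q ->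
  p <= q -> U p -> U q.

Lemma measurable_indic_upset (U : set R) : upset U ->
  measurable_fun (@unit_itv R) (\1_U : R -> R).
Proof.
move=> upU; apply: homo_measurable => p q; rewrite !inE => Dp Dq pq.
rewrite !indicE ler_nat; case: (boolP (p \in U)) => //; rewrite inE => Up.
by rewrite mem_set//; exact: upU Up.
Qed.

Context (Delta : R -> R).
Hypothesis int_Delta : unif01.-integrable (@unit_itv R) (EFin \o Delta).
Hypothesis upset_ge0 : forall U, upset U ->
  0 <= \int[unif01]_(p in @unit_itv R) (\1_U p * Delta p).

Let mD := @measurable_unit_itv R.

(** Integrability is bundled with the sign so that the class is closed under finite sums, hence
    contains staircases. *)
Let good (v : R -> R) :=
  unif01.-integrable (@unit_itv R) (EFin \o (fun p => v p * Delta p)) /\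
  0 <= \int[unif01]_(p in @unit_itv R) (v p * Delta p).

Let good0 : good (fun=> 0).
Proof.
split; first by apply: (integrable_bounded_mul (M := 0) mD) => // x _; rewrite normr0.
by apply: Rintegral_ge0 => p _; rewrite mul0r.
Qed.

Let goodD u v : good u -> good v -> good (fun p => u p + v p).
Proof.
move=> [iu u0] [iv v0].
rewrite /good (_ : (fun p => _) = (fun p => u p * Delta p + v p * Delta p)).
  by split; [exact: (integrableD mD iu iv)|rewrite RintegralD// addr_ge0].
by apply/funext => p; rewrite mulrDl.
Qed.

(** [K.+1%:R * y] is within 1 of a sum of indicators of up-sets, so [K.+1%:R] times the integral is
    at least minus the integral of [|Delta|]. This bound does not depend on [K], so the integral
    cannot be negative. *)
Lemma monotone_weight01 (y : R -> R) :
  {in unit_itv &, {homo y : p q / p <= q}} ->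
  (forall p, unit_itv p -> 0 <= y p <= 1) ->
  0 <= \int[unif01]_(p in @unit_itv R) (y p * Delta p).
Proof.
move=> ndy y01.
have my : measurable_fun (@unit_itv R) y by exact: homo_measurable.
have iy : unif01.-integrable (@unit_itv R) (EFin \o (fun p => y p * Delta p)).
  apply: (integrable_bounded_mul (M := 1) mD) => // p /y01/andP[y0 y1].
  by rewrite ger0_norm.
pose C := \int[unif01]_(p in @unit_itv R) `|Delta p|.
have iC := integrable_norm int_Delta.
suff key K : - C <= K.+1%:R * \int[unif01]_(p in @unit_itv R) (y p * Delta p).
  rewrite leNgt; apply/negP => I0.
  set I := Rintegral _ _ _ in I0 key.
  (* For this [K], [K.+1%:R] exceeds [C / - I], against [key]. *)
  have := key (Num.truncn (C / - I)).
  have := truncnS_gt (C / - I).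
  rewrite ltr_pdivrMr ?oppr_gt0//; lra.
pose s p : R := \sum_(k < K.+1) \1_[set q | k.+1%:R <= K.+1%:R * y q] p.
have [is_ s0] : good s.
  rewrite /s (_ : (fun p => _) =
      \sum_(k < K.+1) (\1_[set q | k.+1%:R <= K.+1%:R * y q] : R -> R)); last first.
    by apply/funext => p; rewrite fct_sumE.
  apply: (big_ind good) => [|u v|k _]; [exact: good0|exact: goodD|].
  have upU : upset [set q | k.+1%:R <= K.+1%:R * y q].
    move=> p q Dp Dq pq /= /le_trans; apply.
    by rewrite ler_wpM2l// ndy// inE.
  split; last exact: upset_ge0.
  apply: (integrable_bounded_mul (M := 1) mD) => //.
    exact: measurable_indic_upset.
  by move=> p _; rewrite indicE; case: (_ \in _); rewrite ?normr1 ?normr0.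
rewrite -RintegralZl//.
have iZ : unif01.-integrable (@unit_itv R)
    (EFin \o (fun p => K.+1%:R * (y p * Delta p))) := integrableZl mD _ iy.
have iN : unif01.-integrable (@unit_itv R)
    (EFin \o (fun p => -1 * `|Delta p|)) := integrableZl mD _ iC.
have -> : - C = \int[unif01]_(p in @unit_itv R) (-1 * `|Delta p|).
  by rewrite RintegralZl// mulN1r.
apply: (@le_trans _ _ (\int[unif01]_(p in @unit_itv R)
    (s p * Delta p + -1 * `|Delta p|))).
  by rewrite RintegralD// lerDr.
apply: le_Rintegral => //.
  exact: (integrableD mD is_ iN).
move=> p Dp; have /andP[y0 y1] := y01 _ Dp.
have : `|K.+1%:R * y p - s p| <= 1.
  rewrite /s; under eq_bigr do rewrite indicE.
  have z01 : 0 <= K.+1%:R * y p <= K.+1%:R.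
    by rewrite mulr_ge0//= ler_piMr.
  rewrite (eq_bigr (fun k : 'I_K.+1 => (k.+1%:R <= K.+1%:R * y p)%R%:R)).
    exact: staircase_approx.
  move=> k _; congr (_%:R); congr nat_of_bool; apply/idP/idP; by rewrite inE.
move=> sy.
have : `|(K.+1%:R * y p - s p) * Delta p| <= `|Delta p|.
  by rewrite normrM ler_piMl.
rewrite ler_norml => /andP[+ _]; rewrite mulrBl -mulrA; lra.
Qed.

(** An affine change of [v] gives a weight with values in [0,1]; the constant it introduces
    integrates to 0 against [Delta]. *)
Lemma monotone_weight (v : R -> R) (M : R) :
  \int[unif01]_(p in @unit_itv R) Delta p = 0 ->
  {in unit_itv &, {homo v : p q / p <= q}} ->
  (forall p, unit_itv p -> `|v p| <= M) ->
  0 <= \int[unif01]_(p in @unit_itv R) (v p * Delta p).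
Proof.
(* Adding 1 keeps the divisor [2 * C] positive when [M = 0]. *)
move=> Delta0 ndv vM; pose C := `|M| + 1.
have C0 : 0 < C by rewrite ltr_wpDl.
have vC p : unit_itv p -> - C <= v p <= C.
  by move=> Dp; rewrite -ler_norml (le_trans (vM _ Dp))// ler_wpDr// ler_norm.
pose y p := (v p + C) / (2 * C).
have ndy : {in unit_itv &, {homo y : p q / p <= q}}.
  move=> p q Dp Dq pq; rewrite ler_wpM2r// ?invr_ge0; first lra.
  by rewrite lerD2r ndv.
have iy : unif01.-integrable (@unit_itv R) (EFin \o (fun p => y p * Delta p)).
  apply: (integrable_bounded_mul (M := 1) mD) => //; first exact: homo_measurable.
  move=> p /vC/andP[v1 v2]; rewrite ger0_norm ?divr_ge0 ?ler_pdivrMr//; lra.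
have y0 := monotone_weight01 ndy.
rewrite (@eq_Rintegral _ _ _ _ _
  (fun p => 2 * C * (y p * Delta p) + - C * Delta p)); last first.
  by move=> p _; rewrite /y; field; rewrite gt_eqF.
have i1 : unif01.-integrable (@unit_itv R)
    (EFin \o (fun p => 2 * C * (y p * Delta p))) := integrableZl mD _ iy.
have i2 : unif01.-integrable (@unit_itv R)
    (EFin \o (fun p => - C * Delta p)) := integrableZl mD _ int_Delta.
rewrite RintegralD//.
rewrite !RintegralZl// Delta0 mulr0 addr0 mulr_ge0//; first lra.
apply: y0 => p /vC/andP[v1 v2]; apply/andP; split.
  by rewrite divr_ge0//; lra.
by rewrite ler_pdivrMr; lra.
Qed.

End monotone_weight.

Lemma integrable_unif01_cst {R : realType} (c : R) :
  unif01.-integrable (@unit_itv R) (EFin \o (fun=> c)).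
Proof.
apply: measurable_bounded_integrable => //.
  exact: measurable_unit_itv.
  by change (unif01 (@unit_itv R) < +oo)%E; rewrite unif01_unit_itv ltry.
by exists `|c|; split; rewrite ?num_real// => M cM p _ /=; exact: ltW.
Qed.

(** * Integrals of a mixture over up-sets *)

Section mixture_upset.
Context {R : realType} (n : nat) (w : 'I_n -> R) (Q : 'I_n -> R -> R) (H : R -> R).
Hypothesis w_ge0 : forall j, 0 <= w j.
Hypothesis w_sum1 : \sum_(j < n) w j = 1.
Hypothesis int_Q : forall j, unif01.-integrable (@unit_itv R) (EFin \o Q j).
Hypothesis ndH : {in unit_itv &, {homo H : p q / p <= q}}.
Hypothesis mixQ : forall f : R -> \bar R, measurable_fun setT f ->
  (forall x, 0 <= f x)%E ->
  (\int[unif01]_(p in unit_itv) f (H p) =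
   \sum_(j < n) (w j)%:E * \int[unif01]_(p in unit_itv) f (Q j p))%E.

Let mD := @measurable_unit_itv R.

Lemma integrable_mixture : unif01.-integrable (@unit_itv R) (EFin \o H).
Proof.
apply/integrableP; split; first by apply/measurable_EFinP; exact: homo_measurable.
have mabs : measurable_fun setT (fun x : R => `|x%:E|%E).
  by apply: measurableT_comp => //; exact: EFin_measurable.
rewrite /= (mixQ mabs)//; apply: lte_sum_pinfty => j _.
have /integrableP[_ iQ] := int_Q j.
by apply: lte_mul_pinfty => //; rewrite lee_fin.
Qed.

Lemma Rintegral_mixture (f : R -> R) : measurable_fun setT f ->
  (forall x, 0 <= f x) ->
  (forall j, unif01.-integrable (@unit_itv R) (EFin \o (f \o Q j))) ->
  \int[unif01]_(p in @unit_itv R) f (H p) =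
  \sum_(j < n) w j * \int[unif01]_(p in @unit_itv R) f (Q j p).
Proof.
move=> mf f0 intf; rewrite /Rintegral.
rewrite (mixQ (f := EFin \o f))//; last exact/measurable_EFinP.
rewrite -sum_fine => [|j _]; last by rewrite fin_numM// (integrable_fin_num mD (intf j)).
apply: eq_bigr => j _; rewrite fineM//.
exact: (integrable_fin_num mD (intf j)).
Qed.

Let int_cst := @integrable_unif01_cst R.

Let int_pos (c : R) (f : R -> R) :
  unif01.-integrable (@unit_itv R) (EFin \o f) ->
  unif01.-integrable (@unit_itv R) (EFin \o (fun p => Num.max (f p - c) 0)).
Proof.
move=> intf; have intB := integrableB mD intf (int_cst c).
apply: le_integrable intB => //.
  apply/measurable_EFinP/measurable_maxr => //.
  apply: measurable_funB => //; apply/measurable_EFinP.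
  exact: measurable_int intf.
move=> p _ /=; rewrite lee_fin.
by have [fc|fc] := leP (f p - c) 0; rewrite ?normr0.
Qed.

Let int_N (f : R -> R) : unif01.-integrable (@unit_itv R) (EFin \o f) ->
  unif01.-integrable (@unit_itv R) (EFin \o (fun p => - f p)).
Proof.
by move=> intf; exact: (integrableN intf).
Qed.

(** [mixQ] speaks of nonnegative functions, so the identity is applied to the positive and the
    negative part of [x] separately. *)
Lemma Rintegral_mixture_mean : \int[unif01]_(p in @unit_itv R) H p =
  \sum_(j < n) w j * \int[unif01]_(p in @unit_itv R) Q j p.
Proof.
have split_mean (f : R -> R) : unif01.-integrable (@unit_itv R) (EFin \o f) ->
    \int[unif01]_(p in @unit_itv R) f p =
    \int[unif01]_(p in @unit_itv R) Num.max (f p - 0) 0 -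
    \int[unif01]_(p in @unit_itv R) Num.max (- f p - 0) 0.
  move=> intf; rewrite -RintegralB//; [|exact: int_pos|exact/int_pos/int_N].
  apply: eq_Rintegral => p _; rewrite !subr0.
  by have [] := leP (f p) 0; have [] := leP (- f p) 0; lra.
rewrite (split_mean _ integrable_mixture).
rewrite (Rintegral_mixture (f := fun x => Num.max (x - 0) 0)); last 3 first.
- by apply: measurable_maxr => //; exact: measurable_funB.
- by move=> x; rewrite le_max lexx orbT.
- by move=> j; exact: int_pos.
rewrite (Rintegral_mixture (f := fun x => Num.max (- x - 0) 0)); last 3 first.
- by apply: measurable_maxr => //; apply: measurable_funB => //; exact: measurable_funN.
- by move=> x; rewrite le_max lexx orbT.
- by move=> j; exact/int_pos/int_N.
by rewrite -sumrB; apply: eq_bigr => j _; rewrite -mulrBr -split_mean.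
Qed.

(** Pointwise, [\1_U * Q j] is at most [\1_U * h] plus the positive part of [Q j - h]. For [H] this
    is an equality, because [h] separates the values of [H] on [U] from those off [U]. *)
Lemma upset_mixture (U : set R) : upset U ->
  \sum_(j < n) w j * \int[unif01]_(p in @unit_itv R) (\1_U p * Q j p) <=
  \int[unif01]_(p in @unit_itv R) (\1_U p * H p).
Proof.
move=> upU.
(* For the cases where [U] misses or contains all of (0,1): the set whose supremum is [h] could be
   unbounded or is empty, and equality of the means settles the claim. *)
have const (c : R) : (forall p, unit_itv p -> \1_U p = c :> R) ->
    \sum_(j < n) w j * \int[unif01]_(p in @unit_itv R) (\1_U p * Q j p) <=
    \int[unif01]_(p in @unit_itv R) (\1_U p * H p).
  move=> Uc.
  have intU f : unif01.-integrable (@unit_itv R) (EFin \o f) ->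
      \int[unif01]_(p in @unit_itv R) (\1_U p * f p) =
      c * \int[unif01]_(p in @unit_itv R) f p.
    move=> intf; rewrite -RintegralZl//; apply: eq_Rintegral => p.
    by rewrite inE => /Uc ->.
  rewrite (intU _ integrable_mixture) Rintegral_mixture_mean mulr_sumr.
  by rewrite le_eqVlt; apply/orP; left; apply/eqP/eq_bigr => j _;
    rewrite intU// mulrCA.
have [[u Du Uu]|/forallPNP noU] := pselect (exists2 p, unit_itv p & U p); last first.
  by apply: (const 0) => p Dp; rewrite indicE memNset//; exact: noU.
have [[v Dv NUv]|/forallPNP allU] := pselect (exists2 p, unit_itv p & ~ U p); last first.
  by apply: (const 1) => p Dp; rewrite indicE mem_set//; apply: contrapT; exact: allU.
pose S := [set H p | p in [set p | unit_itv p /\ ~ U p]].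
pose h := sup S.
have ubS p : unit_itv p -> U p -> ubound S (H p).
  move=> Dp Up _ [q [Dq NUq] <-]; apply: ndH; rewrite ?inE//.
  by rewrite leNgt; apply/negP => pq; apply: NUq; exact: upU (ltW pq) Up.
have hU p : unit_itv p -> U p -> h <= H p.
  by move=> Dp Up; apply: ge_sup; [exists (H v); exists v|exact: ubS].
have hNU p : unit_itv p -> ~ U p -> H p <= h.
  by move=> Dp NUp; apply: ub_le_sup; [exists (H u); exact: ubS|exists p].
have intU (f : R -> R) : unif01.-integrable (@unit_itv R) (EFin \o f) ->
    unif01.-integrable (@unit_itv R) (EFin \o (fun p => \1_U p * f p)).
  move=> intf; apply: (integrable_bounded_mul (M := 1) mD) => //.
    exact: measurable_indic_upset.
  by move=> p _; rewrite indicE; case: (_ \in _); rewrite ?normr1 ?normr0.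
have intUh := intU _ (int_cst h).
have splitH : \int[unif01]_(p in @unit_itv R) (\1_U p * H p) =
    \int[unif01]_(p in @unit_itv R) (\1_U p * h) +
    \int[unif01]_(p in @unit_itv R) Num.max (H p - h) 0.
  rewrite -RintegralD//; last exact: (int_pos _ integrable_mixture).
  apply: eq_Rintegral => p; rewrite inE => Dp; rewrite indicE.
  have [Up|NUp] := pselect (U p).
    by rewrite mem_set//; have hH := hU _ Dp Up; case: (leP (H p - h) 0) => /=; lra.
  by rewrite memNset//; have hH := hNU _ Dp NUp; case: (leP (H p - h) 0) => /=; lra.
rewrite splitH (Rintegral_mixture (f := fun x => Num.max (x - h) 0)); last 3 first.
- by apply: measurable_maxr => //; exact: measurable_funB.
- by move=> x; rewrite le_max lexx orbT.
- by move=> j; exact: int_pos.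
(* The term in [h] is shared out among the [j] with weights [w j], which leaves one comparison for
   each [j]. *)
rewrite -[X in X + _]mul1r -w_sum1 mulr_suml -big_split/=.
apply: ler_sum => j _; rewrite -mulrDr; apply: ler_wpM2l => //.
have iP := int_pos h (int_Q j).
rewrite -RintegralD//; apply: le_Rintegral => //; first exact: intU.
  exact: (integrableD mD intUh iP).
move=> p Dp; rewrite indicE; case: (p \in U); case: (leP (Q j p - h) 0) => /=; lra.
Qed.

End mixture_upset.

(** * Convex functions *)

Section convex_support.
Context {R : realType}.
Implicit Types (phi f g : R -> R).

(** [g] selects a subgradient of [f] at every point. *)
Definition supports g f := forall x y, f x + g x * (y - x) <= f y.

Lemma convex_fun_three_points phi x y z : convex_fun phi -> z < x -> x < y ->
  (y - z) * phi x <= (y - x) * phi z + (x - z) * phi y.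
Proof.
move=> cphi zx xy; have yz : 0 < y - z by lra.
have t01 : 0 <= (y - x) / (y - z) <= 1.
  by rewrite divr_ge0 ?ler_pdivrMr//; lra.
have := cphi z y _ t01.
have -> : (y - x) / (y - z) * z + (1 - (y - x) / (y - z)) * y = x.
  by field; rewrite gt_eqF.
rewrite -(ler_pM2l yz) => /le_trans; apply; rewrite le_eqVlt; apply/orP; left.
by apply/eqP; field; rewrite gt_eqF.
Qed.

(* The witness is the left derivative of [phi]. *)
Lemma convex_fun_supports phi : convex_fun phi -> exists g, supports g phi.
Proof.
move=> cphi; pose S x := [set (phi x - phi z) / (x - z) | z in [set z | z < x]].
(* Chords to the left of [x] are no steeper than chords to its right: this bounds [S x] above and
   yields the tangent inequality for [y > x]. *)
have slope x y s : x < y -> S x s -> s <= (phi y - phi x) / (y - x).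
  move=> xy [z /= zx <-].
  have := convex_fun_three_points cphi zx xy.
  rewrite ler_pdivrMr ?subr_gt0// mulrAC ler_pdivlMr ?subr_gt0//; lra.
have Sub x : has_ubound (S x).
  by exists ((phi (x + 1) - phi x) / (x + 1 - x)) => s; apply: slope; lra.
exists (fun x => sup (S x)) => x y; have [xy|yx|->] := ltgtP x y.
- have : sup (S x) <= (phi y - phi x) / (y - x).
    apply: ge_sup; last by move=> s; exact: slope.
    by exists ((phi x - phi (x - 1)) / (x - (x - 1))); exists (x - 1) => //=; lra.
  by rewrite ler_pdivlMr ?subr_gt0//; lra.
- have : (phi x - phi y) / (x - y) <= sup (S x).
    by apply: ub_le_sup => //; exists y.
  by rewrite ler_pdivrMr ?subr_gt0//; lra.
- by rewrite subrr mulr0 addr0.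
Qed.

(** Adding the tangent inequalities at [x] and at [y] gives [(g y - g x) * (y - x) >= 0]. *)
Lemma supports_homo g f : supports g f -> {homo g : x y / x <= y}.
Proof.
move=> gf x y; rewrite le_eqVlt => /predU1P[->//|xy].
have yx : 0 < y - x by lra.
have h1 := gf x y; have h2 := gf y x; rewrite -(ler_pM2r yx); lra.
Qed.

(** Strict sublevel sets are intervals: for [u] between [s] and [t], the tangent at [u] gives
    [f u <= f t] if [g u >= 0], and [f u <= f s] otherwise. *)
Lemma supports_measurable g f : supports g f -> measurable_fun setT f.
Proof.
move=> gf; apply: (measurability (@RGenInftyO.G R)) => [|/= _ [_] [r] -> <-].
  exact: RGenInftyO.measurableE.
rewrite setTI; apply: is_interval_measurable => s t /=.
rewrite !in_itv/= => fs ft u /andP[su ut]; rewrite in_itv/=.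
have [gu|gu] := leP 0 (g u).
  have : 0 <= g u * (t - u) by rewrite mulr_ge0//; lra.
  by have := gf u t; lra.
have : 0 <= g u * (s - u) by rewrite mulr_le0//; lra.
by have := gf u s; lra.
Qed.

Definition clamp (N x : R) := Num.max (- N) (Num.min x N).

(** The tangent at the point of [-N, N] nearest to [x], evaluated at [x]; inside the interval the
    linear term vanishes and [f x] remains. *)
Definition affine_cut N f g x := f (clamp N x) + g (clamp N x) * (x - clamp N x).

Section affine_cut.
Context (N : R) (f g : R -> R).
Hypotheses (N0 : 0 <= N) (gf : supports g f).

Lemma clamp_cases (x : R) : [\/ x < - N /\ clamp N x = - N,
  (- N <= x <= N) /\ clamp N x = x | N < x /\ clamp N x = N].
Proof.
have NN : - N <= N by rewrite (le_trans _ N0) ?oppr_le0.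
have [Nx|xN] := ltP N x.
  by apply: Or33; rewrite /clamp min_r ?ltW// max_r.
have [xN'|Nx] := ltP x (- N).
  by apply: Or31; rewrite /clamp min_l// max_l// ltW.
by apply: Or32; rewrite /clamp min_l// max_r.
Qed.

Lemma clamp_itv x : - N <= clamp N x <= N.
Proof. by have := N0; case: (clamp_cases x) => -[xN ->]; lra. Qed.

Lemma clamp_homo : {homo clamp N : x y / x <= y}.
Proof.
have := N0; move=> ? x y xy; case: (clamp_cases x) => -[xN ->];
  case: (clamp_cases y) => -[yN ->]; lra.
Qed.

(** To the tangent inequality between [t] and [clamp N y] is added the remaining increment
    [y - clamp N y], whose sign is never opposite to that of [g (clamp N y) - g t]. *)
Lemma affine_cut_ge_tangent t y : - N <= t <= N ->
  f t + g t * (y - t) <= affine_cut N f g y.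
Proof.
move=> tN; have ndg := supports_homo gf; have := N0 => ?; rewrite /affine_cut.
have := gf t (clamp N y).
suff : 0 <= (g (clamp N y) - g t) * (y - clamp N y) by lra.
case: (clamp_cases y) => -[yN ->].
- by apply: mulr_le0; [rewrite subr_le0 ndg//; lra|lra].
- by rewrite subrr mulr0.
- by apply: mulr_ge0; [rewrite subr_ge0 ndg//; lra|lra].
Qed.

Lemma affine_cut_supports : supports (g \o clamp N) (affine_cut N f g).
Proof.
move=> x y; have := affine_cut_ge_tangent y (clamp_itv x).
rewrite /affine_cut /=; lra.
Qed.

Lemma affine_cut_le x : affine_cut N f g x <= f x.
Proof. exact: gf. Qed.

Lemma affine_cut_id x : - N <= x <= N -> affine_cut N f g x = f x.
Proof.
by rewrite /affine_cut => xN; case: (clamp_cases x) => -[? ->]; lra.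
Qed.

Lemma affine_cut_slope_bound x :
  `|g (clamp N x)| <= `|g (- N)| + `|g N|.
Proof.
have ndg := supports_homo gf; have /andP[c1 c2] := clamp_itv x.
have := ndg _ _ c1; have := ndg _ _ c2.
have := ler_norm (g N); have := ler_norm (- g (- N)).
have := normr_ge0 (g N); have := normr_ge0 (g (- N)); rewrite normrN ler_norml.
by move=> ? ? ? ? ? ?; apply/andP; split; lra.
Qed.

End affine_cut.
End convex_support.

(** * From monotone weights to the convex order *)

Section convex_order_criterion.
Context {R : realType} (Q H : R -> R).
Hypothesis int_Q : unif01.-integrable (@unit_itv R) (EFin \o Q).
Hypothesis int_H : unif01.-integrable (@unit_itv R) (EFin \o H).
Hypothesis ndQ : {in unit_itv &, {homo Q : p q / p <= q}}.
Hypothesis weight_ge0 : forall (v : R -> R) (M : R),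
  {in unit_itv &, {homo v : p q / p <= q}} ->
  (forall p, unit_itv p -> `|v p| <= M) ->
  0 <= \int[unif01]_(p in @unit_itv R) (v p * (H p - Q p)).

Let mD := @measurable_unit_itv R.

Let int_cst (c : R) : unif01.-integrable (@unit_itv R) (EFin \o (fun=> c)).
Proof. exact: integrable_unif01_cst. Qed.

Let measurable_comp_integrable (f X : R -> R) : measurable_fun setT f ->
  unif01.-integrable (@unit_itv R) (EFin \o X) ->
  measurable_fun (@unit_itv R) (f \o X).
Proof.
move=> mf iX; apply: measurableT_comp => //.
by apply/measurable_EFinP; exact: measurable_int iX.
Qed.

Section nonnegative.
Context (f g : R -> R).
Hypotheses (gf : supports g f) (g00 : g 0 = 0) (f00 : f 0 = 0).

Let fN (N : nat) := affine_cut N%:R f g.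

Let measurable_fN N : measurable_fun setT (fN N).
Proof. exact: supports_measurable (affine_cut_supports (ler0n _ _) gf). Qed.

(** The tangent at 0 is the zero function and lies below the cut. *)
Let fN_ge0 N x : 0 <= fN N x.
Proof.
have zN : - N%:R <= (0:R) <= N%:R by rewrite oppr_le0 ler0n.
have := affine_cut_ge_tangent (ler0n _ N) gf x zN.
by rewrite f00 g00 mul0r addr0.
Qed.

(** Bounded slopes give linear growth: the subgradient inequality from [X p] to 0 yields the bound
    [fN N 0 + M * |X p|]. *)
Let integrable_fN (N : nat) (X : R -> R) :
  unif01.-integrable (@unit_itv R) (EFin \o X) ->
  unif01.-integrable (@unit_itv R) (EFin \o (fN N \o X)).
Proof.
move=> iX; pose M := `|g (- N%:R)| + `|g N%:R|.
have iM : unif01.-integrable (@unit_itv R)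
    (EFin \o (fun p => fN N 0 + M * `|X p|)).
  exact: (integrableD mD (int_cst _) (integrableZl mD _ (integrable_norm iX))).
apply: le_integrable iM => //.
  by apply/measurable_EFinP; exact: measurable_comp_integrable.
move=> p _ /=; rewrite lee_fin ger0_norm// [leRHS]ger0_norm; last first.
  by rewrite addr_ge0// mulr_ge0// addr_ge0.
have N0 : 0 <= N%:R :> R by [].
have /= := affine_cut_supports N0 gf (X p) 0; rewrite -/(fN N) sub0r mulrN lerBlDr.
move=> /le_trans; apply; rewrite lerD2l (le_trans (ler_norm _))//.
by rewrite normrM ler_wpM2r// (affine_cut_slope_bound N0 gf).
Qed.

Let le_integral_fN N : (\int[unif01]_(p in @unit_itv R) (fN N (Q p))%:E <=
  \int[unif01]_(p in @unit_itv R) (f (H p))%:E)%E.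
Proof.
have N0 : 0 <= N%:R :> R by [].
have ndg := supports_homo gf.
pose v p := g (clamp N%:R (Q p)); pose M := `|g (- N%:R)| + `|g N%:R|.
have ndv : {in unit_itv &, {homo v : p q / p <= q}}.
  by move=> p q Dp Dq pq; apply/ndg/clamp_homo => //; exact: ndQ.
have vM p : unit_itv p -> `|v p| <= M.
  by move=> _; exact: (affine_cut_slope_bound N0 gf).
have iQ := integrable_fN N int_Q; have iH := integrable_fN N int_H.
have iv : unif01.-integrable (@unit_itv R) (EFin \o (fun p => v p * (H p - Q p))).
  apply: (integrable_bounded_mul mD _ vM); first exact: homo_measurable.
  exact: (integrableB mD int_H int_Q).
(* The subgradient inequality of the cut at [Q p], with slope [v p]; being bounded and
   nondecreasing, [v] is an admissible weight. *)
have leI : \int[unif01]_(p in @unit_itv R) fN N (Q p) <=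
    \int[unif01]_(p in @unit_itv R) fN N (H p).
  apply: (@le_trans _ _ (\int[unif01]_(p in @unit_itv R)
      (fN N (Q p) + v p * (H p - Q p)))).
    by rewrite RintegralD// lerDl; exact: weight_ge0 vM.
  apply: le_Rintegral => //; first exact: (integrableD mD iQ iv).
  by move=> p _; exact: affine_cut_supports.
apply: (@le_trans _ _ (\int[unif01]_(p in @unit_itv R) (fN N (H p))%:E)%E).
  rewrite -[leLHS]fineK ?(integrable_fin_num mD iQ)//.
  by rewrite -[leRHS]fineK ?(integrable_fin_num mD iH)// lee_fin.
apply: (ge0_le_integral _ mD).
- by move=> p _; rewrite lee_fin fN_ge0.
- by apply/measurable_EFinP; exact: measurable_comp_integrable.
- apply/measurable_EFinP; apply: measurable_comp_integrable => //.
  exact: supports_measurable gf.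
- by move=> p _; rewrite lee_fin; exact: affine_cut_le.
Qed.

(** The cuts are nonnegative and, at each [Q p], equal to [f] once [N >= |Q p|]; Fatou's lemma
    carries the bound of [le_integral_fN] to the limit. *)
Lemma le_integral_convex_ge0 :
  (\int[unif01]_(p in @unit_itv R) (f (Q p))%:E <=
   \int[unif01]_(p in @unit_itv R) (f (H p))%:E)%E.
Proof.
have fN_lim p : limn_einf (fun N => (fN N (Q p))%:E) = (f (Q p))%:E.
  apply: (cvg_limn_einf_sup _).1; apply: cvg_near_cst.
  near=> N; congr EFin; apply: affine_cut_id => //.
  by rewrite -ler_norml; near: N; exact: nbhs_infty_ger.
have -> : (\int[unif01]_(p in @unit_itv R) (f (Q p))%:E =
    \int[unif01]_(p in @unit_itv R) limn_einf (fun N => (fN N (Q p))%:E))%E.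
  by apply: eq_integral => p _; rewrite fN_lim.
apply: (le_trans (fatou unif01 mD _ _)).
- by move=> N; apply/measurable_EFinP; exact: measurable_comp_integrable.
- by move=> N p _; rewrite lee_fin fN_ge0.
rewrite limn_einf_lim; apply: lime_le; first exact: is_cvg_einfs.
near=> N; apply: le_trans (le_integral_fN N).
by apply: ereal_inf_lbound; exists N => //=.
Unshelve. all: by end_near. Qed.

End nonnegative.

(** Subtracting the tangent [l] at 0 reduces [phi] to the nonnegative [f], whose subgradient
    vanishes at 0. What follows adds [l] back with care for infinite integrals. *)
Lemma le_integral_convex (phi : R -> R) : convex_fun phi ->
  (\int[unif01]_(p in @unit_itv R) (phi (Q p))%:E <=
   \int[unif01]_(p in @unit_itv R) (phi (H p))%:E)%E.
Proof.
move=> /convex_fun_supports[g gphi].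
pose l x := phi 0 + g 0 * x; pose f x := phi x - l x.
have gf : supports (fun x => g x - g 0) f.
  by move=> x y; have := gphi x y; rewrite /f /l; lra.
have f_ge0 x : 0 <= f x by have := gphi 0 x; rewrite /f /l; lra.
have f00 : f 0 = 0 by rewrite /f /l; lra.
have fQH := le_integral_convex_ge0 gf (subrr _) f00.
have mphi := supports_measurable gphi.
have mf := supports_measurable gf.
have il X : unif01.-integrable (@unit_itv R) (EFin \o X) ->
    unif01.-integrable (@unit_itv R) (EFin \o (l \o X)).
  move=> iX.
  exact: (integrableD mD (int_cst _) (integrableZl mD _ iX)).
(* The difference of the two sides is the integral of [H - Q] against the constant weight [g 0]. *)
have lQH : (\int[unif01]_(p in @unit_itv R) (l (Q p))%:E <=
    \int[unif01]_(p in @unit_itv R) (l (H p))%:E)%E.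
  have iQ := il _ int_Q; have iH := il _ int_H.
  rewrite -[leLHS]fineK ?(integrable_fin_num mD iQ)//.
  rewrite -[leRHS]fineK ?(integrable_fin_num mD iH)// lee_fin -subr_ge0.
  rewrite -[X in _ <= X]/(Rintegral _ _ (l \o H) - Rintegral _ _ (l \o Q)).
  rewrite -RintegralB//.
  rewrite (@eq_Rintegral _ _ _ _ _ (fun p => g 0 * (H p - Q p))).
    exact: (weight_ge0 (M := `|g 0|)).
  by move=> p _; rewrite /l /=; lra.
have iphi X : unif01.-integrable (@unit_itv R) (EFin \o X) ->
    unif01.-integrable (@unit_itv R) (EFin \o (f \o X)) ->
    unif01.-integrable (@unit_itv R) (EFin \o (phi \o X)) /\
    (\int[unif01]_(p in @unit_itv R) (phi (X p))%:E =
     \int[unif01]_(p in @unit_itv R) (f (X p))%:E +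
     \int[unif01]_(p in @unit_itv R) (l (X p))%:E)%E.
  move=> iX ifX; have -> : phi \o X = (fun p => f (X p) + l (X p)).
    by apply/funext => p; rewrite /f /= subrK.
  split; first exact: (integrableD mD ifX (il _ iX)).
  rewrite -(integralD mD ifX (il _ iX)); apply: eq_integral => p _.
  by rewrite /= -EFinD /f subrK.
have if_lty X : unif01.-integrable (@unit_itv R) (EFin \o X) ->
    (\int[unif01]_(p in @unit_itv R) (f (X p))%:E < +oo)%E ->
    unif01.-integrable (@unit_itv R) (EFin \o (f \o X)).
  move=> iX fX; apply/integrableP; split.
    by apply/measurable_EFinP; exact: measurable_comp_integrable.
  apply: le_lt_trans fX; rewrite le_eqVlt; apply/orP; left; apply/eqP.
  by apply: eq_integral => p _ /=; rewrite ger0_norm.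
have [fH|fHoo] := ltP (\int[unif01]_(p in @unit_itv R) (f (H p))%:E)%E +oo%E.
  have [_ ->] := iphi _ int_H (if_lty _ int_H fH).
  have [_ ->] := iphi _ int_Q (if_lty _ int_Q (le_lt_trans fQH fH)).
  exact: leeD.
(* As [f >= 0], the negative part of [phi (H p)] is at most [|l (H p)|], hence integrable. The
   positive part is not, since [f (H p)] is at most this part plus [|l (H p)|]. *)
suff -> : (\int[unif01]_(p in @unit_itv R) (phi (H p))%:E = +oo)%E by rewrite leey.
pose phiH := EFin \o (phi \o H).
have mphiH : measurable_fun (@unit_itv R) phiH.
  by apply/measurable_EFinP; exact: measurable_comp_integrable.
have /integrableP[_ labs] := il _ int_H.
have mlH : measurable_fun (@unit_itv R) (fun p => `|(l (H p))%:E|)%E.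
  apply: measurableT_comp => //; exact: (measurable_int unif01 (il _ int_H)).
have nphiH : (\int[unif01]_(p in @unit_itv R) phiH^\- p < +oo)%E.
  apply: le_lt_trans labs; apply: (ge0_le_integral _ mD) => //.
    exact: measurable_funeneg.
  move=> p _ /=; rewrite funenegE /phiH/= -EFin_max lee_fin.
  have := f_ge0 (H p); rewrite /f ge_max normr_ge0 andbT.
  by have := ler_norm (- l (H p)); rewrite normrN; lra.
have pphiH : (\int[unif01]_(p in @unit_itv R) phiH^\+ p = +oo)%E.
  apply/eqP; rewrite -leye_eq; apply/contraT; rewrite -ltNge => plty.
  suff : (\int[unif01]_(p in @unit_itv R) (f (H p))%:E < +oo)%E.
    by rewrite ltNge fHoo.
  apply: le_lt_trans (lte_add_pinfty plty labs).
  rewrite -ge0_integralD//; last exact: measurable_funepos.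
  apply: (ge0_le_integral _ mD) => //.
  - by move=> p _; rewrite lee_fin.
  - by apply/measurable_EFinP; exact: measurable_comp_integrable.
  - by apply: emeasurable_funD => //; exact: measurable_funepos.
  move=> p _ /=; rewrite funeposE /phiH/= -EFin_max -EFinD lee_fin.
  have : phi (H p) <= Num.max (phi (H p)) 0 by rewrite le_max lexx.
  by have := ler_norm (- l (H p)); rewrite normrN /f; lra.
rewrite integralE.
by rewrite [X in (X - _)%E]pphiH addye// -ltNye lteNr.
Qed.

End convex_order_criterion.

(** * Comonotone sums *)

Lemma Rintegral_sum d (T : measurableType d) (R : realType)
    (mu : {measure set T -> \bar R}) (D : set T) (n : nat) (f : 'I_n -> T -> R) :
  measurable D -> (forall i, mu.-integrable D (EFin \o f i)) ->
  \int[mu]_(x in D) (\sum_(i < n) f i x) = \sum_(i < n) \int[mu]_(x in D) f i x.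
Proof.
move=> mD intf; rewrite /Rintegral; under eq_integral do rewrite -sumEFin.
rewrite (integral_sum mD intf) -sum_fine// => i _.
exact: (integrable_fin_num mD (intf i)).
Qed.

Section comonotone_sums.
Context {R : realType} (n : nat) (F : 'I_n -> R -> R) (L : 'M[R]_n).
Hypotheses (M1F : forall i, M1 (F i)) (dsL : doubly_stochastic L).

Let mD := @measurable_unit_itv R.

Let cdfF i : is_cdf (F i). Proof. by case: (M1F i). Qed.

Let L_ge0 i j : 0 <= L i j. Proof. by case: dsL. Qed.

Let L_row i : \sum_(j < n) L i j = 1. Proof. by case: dsL. Qed.

Let cdf_mixF i : is_cdf (mixF L F i).
Proof. exact: (is_cdf_mixture (L_ge0 i) (L_row i) cdfF). Qed.

Let mixQ i := fun f => quantile_mixture_integral (L_ge0 i) (L_row i) cdfF (f := f).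

Let int_Q j := quantile_integrable (M1F j).

Let ndH i := galois_quantile_homo (quantile_galois (cdf_mixF i)).

Let int_H i : unif01.-integrable (@unit_itv R) (EFin \o quantile (mixF L F i)).
Proof. exact: (integrable_mixture (L_ge0 i) int_Q (ndH i) (mixQ i)). Qed.

Let Q p := \sum_(i < n) quantile (F i) p.
Let H p := \sum_(i < n) quantile (mixF L F i) p.

Let int_sum (f : 'I_n -> R -> R) :
  (forall i, unif01.-integrable (@unit_itv R) (EFin \o f i)) ->
  unif01.-integrable (@unit_itv R) (EFin \o (fun p => \sum_(i < n) f i p)).
Proof.
move=> intf.
have := integrable_sum mD (index_enum 'I_n) (P := xpredT) (fun i _ => intf i).
by apply: eq_integrable => // p _; rewrite /= -sumEFin.
Qed.

(** The column sums of [L] enter here; the row sums make each component a mixture. *)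
Let sum_swap (x : 'I_n -> R) :
  \sum_(i < n) \sum_(j < n) L i j * x j = \sum_(j < n) x j.
Proof.
rewrite exchange_big; apply: eq_bigr => j _; rewrite -mulr_suml.
by case: dsL => _ _ ->; rewrite mul1r.
Qed.

Let upset_sums U : upset U ->
  0 <= \int[unif01]_(p in @unit_itv R) (\1_U p * (H p - Q p)).
Proof.
move=> upU.
have intU (f : R -> R) : unif01.-integrable (@unit_itv R) (EFin \o f) ->
    unif01.-integrable (@unit_itv R) (EFin \o (fun p => \1_U p * f p)).
  move=> intf; apply: (integrable_bounded_mul (M := 1) mD) => //.
    exact: measurable_indic_upset.
  by move=> p _; rewrite indicE; case: (_ \in _); rewrite ?normr1 ?normr0.
have iH := fun i => intU _ (int_H i); have iQ := fun i => intU _ (int_Q i).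
rewrite (@eq_Rintegral _ _ _ _ _ (fun p =>
    \sum_(i < n) \1_U p * quantile (mixF L F i) p -
    \sum_(i < n) \1_U p * quantile (F i) p)); last first.
  by move=> p _; rewrite -!mulr_sumr -mulrBr.
rewrite RintegralB//; [|exact: int_sum|exact: int_sum].
(* [sum_swap] regroups the integrals of the [Q j] by rows, so that row [i] is compared with the
   [i]-th mixture. *)
rewrite !Rintegral_sum// subr_ge0 -[leLHS]sum_swap; apply: ler_sum => i _.
exact: (upset_mixture (L_ge0 i) (L_row i) int_Q (ndH i) (mixQ i)).
Qed.

Let mean_sums : \int[unif01]_(p in @unit_itv R) (H p - Q p) = 0.
Proof.
rewrite RintegralB//; [|exact: int_sum|exact: int_sum].
rewrite !Rintegral_sum// -[X in _ - X]sum_swap; apply/eqP.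
rewrite subr_eq0; apply/eqP/eq_bigr => i _.
exact: (Rintegral_mixture_mean (L_ge0 i) int_Q (ndH i) (mixQ i)).
Qed.

(** A sum of quantile functions is nondecreasing and left continuous on (0,1), hence in Galois
    connection with [comon_sum K]. *)
Lemma cdf_int_comon_sum (K : 'I_n -> R -> R) phi : (forall i, is_cdf (K i)) ->
  convex_fun phi -> cdf_int (comon_sum K) phi =
  (\int[unif01]_(p in @unit_itv R) (phi (\sum_(i < n) quantile (K i) p))%:E)%E.
Proof.
move=> cK /convex_fun_supports[g /supports_measurable mphi].
have qK : quantile_like (fun p => \sum_(i < n) quantile (K i) p).
  apply: quantile_like_sum => i.
  exact: (galois_quantile_like (is_cdf_bounds (cK i)) (quantile_galois (cK i))).
have mphiE : measurable_fun setT (fun x => (phi x)%:E) by exact/measurable_EFinP.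
exact: (LS_integral (@cdf_of_quantile_bounds _ _) (cdf_of_quantile_galois qK) mphiE).
Qed.

Lemma cx_le_comon_sum_mixF : cx_le (comon_sum F) (comon_sum (mixF L F)).
Proof.
move=> phi cphi; rewrite !cdf_int_comon_sum//.
apply: (@le_integral_convex _ Q H) => //; [exact: int_sum|exact: int_sum| |].
- have [] // : quantile_like Q; apply: quantile_like_sum => i.
  exact: (galois_quantile_like (is_cdf_bounds (cdfF i)) (quantile_galois (cdfF i))).
- move=> v M ndv vM; apply: (monotone_weight _ upset_sums mean_sums ndv vM).
  exact: (integrableB mD (int_sum int_H) (int_sum int_Q)).
Qed.

End comonotone_sums.

(** By transitivity it suffices to compare the two comonotone sums. *)
Theorem theorem6 (R : realType) (n : nat) (F : 'I_n -> R -> R)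
  (L : 'M[R]_n) :
  (forall i, M1 (F i)) -> doubly_stochastic L ->
  Cset F `<=` Cset (mixF L F).
Proof.
move=> M1F dsL G [M1G GF]; split; first exact: M1G.
move=> phi cphi; apply: (le_trans (GF _ cphi)).
exact: (cx_le_comon_sum_mixF M1F dsL cphi).
Qed.
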